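(* Let $\sigma:\mathbb{R}\to\mathbb{R}$ be a continuous discriminatory function. Let $n\ge1$ and let $\mathbf{A},\mathbf{B}\in\mathbb{R}^{n\times n}$ be non-singular diagonalizable matrices such that (i) $\mathbf{A}^q=a\mathbf{I}$ for some positive integer $q\le n$ and some scalar $a\neq0$; (ii) $\mathbf{I}-a\mathbf{B}^q$ is nonsingular; (iii) the eigenvalues of $\mathbf{B}$ have pairwise distinct absolute values. Then for every continuous function $f:[0,1]^n\to\mathbb{R}$ and every $\epsilon>0$ there exist a positive integer $k$, a matrix $\mathbf{W}=[\mathbf{w}_1|\cdots|\mathbf{w}_{kn}]=[\mathbf{W}_1|\mathbf{W}_2|\cdots|\mathbf{W}_k]\in\mathbb{R}^{n\times kn}$ whose $n\times n$ blocks $\mathbf{W}_i$ each satisfy $\mathbf{W}_i-\mathbf{A}\mathbf{W}_i\mathbf{B}=\mathbf{g}_i\mathbf{h}_i^T$ for some $\mathbf{g}_i,\mathbf{h}_i\in\mathbb{R}^n$ (i.e. have Stein displacement rank at most $1$), and real numbers $\alpha_1,\dots,\alpha_{kn},\theta_1,\dots,\theta_{kn}$ such that the function $$G(\mathbf{x})=\sum_{j=1}^{kn}\alpha_j\,\sigma(\mathbf{w}_j^T\mathbf{x}+\theta_j)$$ satisfies $\max_{\mathbf{x}\in[0,1]^n}|G(\mathbf{x})-f(\mathbf{x})|<\epsilon$.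
   Context: A function $\sigma:\mathbb{R}\to\mathbb{R}$ is called discriminatory if the zero measure is the only finite signed regular Borel measure $\mu$ on $[0,1]^n$ such that $\int_{[0,1]^n}\sigma(\mathbf{w}^T\mathbf{x}+\theta)\,d\mu(\mathbf{x})=0$ for all $\mathbf{w}\in\mathbb{R}^n$ and $\theta\in\mathbb{R}$. $\mathbf{w}_j$ denotes the $j$-th column of $\mathbf{W}$. *)

(* Defs.v *)
From HB Require Import structures.
From mathcomp Require Import all_boot all_order all_algebra.
From mathcomp Require Import all_classical all_reals all_analysis.
From mathcomp.real_closed Require Import complex.
Import Order.TTheory GRing.Theory Num.Theory numFieldNormedType.Exports.
Set Implicit Arguments. Unset Strict Implicit. Unset Printing Implicit Defensive.
Local Open Scope classical_set_scope.
Local Open Scope ring_scope.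

Section defs.
Variable R : realType.

Definition cube (n : nat) : set 'rV[R]_n :=
  [set x | forall i : 'I_n, 0 <= x 0 i <= 1].
Arguments cube : clear implicits.

Definition Rn_borel (n : nat) := g_sigma_algebraType (@open 'rV[R]_n).

Definition regular_measure (n : nat)
  (mu : {measure set (Rn_borel n) -> \bar R}) : Prop :=
  forall A : set (Rn_borel n), measurable A ->
    mu A = ereal_inf [set mu U | U in [set U : set 'rV[R]_n | open U /\ A `<=` U]]
    /\ mu A = ereal_sup [set mu K | K in [set K : set 'rV[R]_n | compact K /\ K `<=` A]].

(* A finite signed regular Borel measure on [0,1]^n is represented as
   mu1 - mu2 with mu1, mu2 finite positive regular Borel measures
   concentrated on [0,1]^n (Jordan decomposition).  It is the zero
   measure iff mu1 and mu2 agree on every Borel set. *)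
Definition discriminatory (n : nat) (sigma : R -> R) : Prop :=
  forall mu1 mu2 : {finite_measure set (Rn_borel n) -> \bar R},
    mu1 (~` cube n) = 0%E -> mu2 (~` cube n) = 0%E ->
    regular_measure mu1 -> regular_measure mu2 ->
    (forall (w : 'cV[R]_n) (theta : R),
       (\int[mu1]_(x in cube n) (sigma ((x *m w) 0 0 + theta))%:E
        = \int[mu2]_(x in cube n) (sigma ((x *m w) 0 0 + theta))%:E)%E) ->
    forall A : set (Rn_borel n), measurable A -> mu1 A = mu2 A.

Definition diagonalizableC (n : nat) (M : 'M[R]_n) : Prop :=
  diagonalizable (map_mx (fun r : R => (r%:C)%C) M).

Definition eigs_distinct_abs (n : nat) (M : 'M[R]_n) : Prop :=
  exists lam : 'I_n -> R[i],
    char_poly (map_mx (fun r : R => (r%:C)%C) M) = \prod_(i < n) ('X - (lam i)%:P)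
    /\ forall i j : 'I_n, i != j -> `|lam i| != `|lam j|.

Lemma block_col_lt (n k : nat) (i : 'I_k) (c : 'I_n) : (i * n + c < k * n)%N.
Proof.
case: i c => i hi [c hc] /=.
apply: (leq_trans (n := i * n + n)); first by rewrite ltn_add2l.
by rewrite -mulSnr leq_mul2r hi orbT.
Qed.

Definition block_col (n k : nat) (i : 'I_k) (c : 'I_n) : 'I_(k * n) :=
  Ordinal (block_col_lt i c).

Definition block (n k : nat) (W : 'M[R]_(n, k * n)) (i : 'I_k) : 'M[R]_n :=
  \matrix_(r < n, c < n) W r (block_col i c).

End defs.
Arguments cube {R} n.

(* Main.v *)
(* Since [B] is real and its eigenvalues have distinct absolute values, each of
   them is fixed by conjugation, so [B] has a real left eigenvector [h^T], say
   for [mu].  Every block [w *m h^T] then has displacement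
   [(w - mu *: (A *m w)) *m h^T] of rank one, and if [h] is normalised to have
   an entry 1 in position [c], its column [c] is the arbitrary vector [w].
   Giving weight 0 to the other columns, the theorem reduces to the density of
   the networks [\sum_j alpha_j sigma (w_j^T x + theta_j)] in C([0,1]^n).

   Density is proved without duality.  A finite difference of order [m] along a
   segment of the cube is the integral against a signed measure with finite
   support, so a discriminatory [sigma] has, for every [m], a nonzero finite
   difference [Delta_h^m sigma theta].  Let [Phi_m] be an [m]-fold primitive of
   [sigma].  By Riemann sums, [Delta_h^m Phi_m] is a uniform limit of
   combinations of translates of [sigma]; its [m]-th derivative at [theta] is
   [Delta_h^m sigma theta <> 0], so rescaling its Taylor expansion at [theta]
   yields the ridge monomial [(w^T x + b)^m] in the closure, by induction on
   [m].  Differentiating ridge monomials with respect to [w] and [b] gives all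
   products of affine forms, and Bernstein polynomials conclude. *)
Require Import Defs.
From HB Require Import structures.
From mathcomp Require Import all_boot all_order all_algebra.
From mathcomp Require Import all_classical all_reals all_analysis.
From mathcomp.real_closed Require Import complex.
From mathcomp Require Import measurable_realfun ring lra.
Import Order.TTheory GRing.Theory Num.Theory numFieldNormedType.Exports.
Set Implicit Arguments. Unset Strict Implicit. Unset Printing Implicit Defensive.
Local Open Scope classical_set_scope.
Local Open Scope ring_scope.

(** * Measures with finite support *)

Lemma finite_closed {R : realType} {n : nat} (A : set 'rV[R]_n) :
  finite_set A -> closed A.
Proof.
apply: (accessible_finite_set_closed.1 _ A).
exact/hausdorff_accessible/norm_hausdorff.
Qed.

Section finite_dirac_sums.
Context {R : realType} {n : nat} (x : nat -> 'rV[R]_n).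

Definition dirac_sum (s : seq nat) : set (Rn_borel R n) -> \bar R :=
  msum (fun k => \d_(x (nth 0%N s k) : Rn_borel R n)) (size s).

HB.instance Definition _ (s : seq nat) := Measure.on (dirac_sum s).

Lemma dirac_sumE (s : seq nat) (A : set (Rn_borel R n)) :
  dirac_sum s A = (\sum_(j <- s) (x j \in A)%:R)%:E.
Proof.
rewrite /dirac_sum /msum (big_nth 0%N) big_mkord -sumEFin.
by apply: eq_bigr => k _; exact: diracE.
Qed.

Lemma dirac_sum_fin (s : seq nat) : fin_num_fun (dirac_sum s).
Proof. by move=> A _; rewrite dirac_sumE. Qed.

HB.instance Definition _ (s : seq nat) :=
  Measure_isFinite.Build _ _ _ (dirac_sum s) (@dirac_sum_fin s).

(** The mass of a set depends only on the nodes it contains. Removing from the space the finitely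
    many nodes outside [A] gives an optimal open set, and the nodes inside [A] form an optimal
    compact set. *)
Lemma dirac_sum_regular (s : seq nat) : regular_measure (dirac_sum s).
Proof.
move=> A _.
have lesum (B C : set 'rV[R]_n) :
    (forall j, j \in s -> B (x j) -> C (x j)) ->
    (dirac_sum s B <= dirac_sum s C)%E.
  move=> BC; rewrite !dirac_sumE lee_fin big_seq [leRHS]big_seq.
  apply: ler_sum => j js; rewrite ler_nat.
  by have [/set_mem/(BC _ js)/mem_set ->|] := boolP (x j \in B).
have finx (P : set 'rV[R]_n) : finite_set ([set x j | j in [set` s]] `&` P).
  by apply: finite_setIl; apply: finite_image; exact: finite_seq.
split.
- apply/eqP; rewrite eq_le; apply/andP; split.
    apply: le_ereal_inf_tmp => _ [U [_ AU] <-]; apply: lesum => j _.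
    exact: AU.
  pose U := ~` ([set x j | j in [set` s]] `&` ~` A).
  apply: (@le_trans _ _ (dirac_sum s U)).
    apply: ereal_inf_lbound; exists U => //; split; last by move=> y Ay [_]; exact.
    by apply: closed_openC; apply: finite_closed; exact: finx.
  apply: lesum => j js nxj; apply: contrapT => nA; apply: nxj; split => //.
  by exists j.
- apply/eqP; rewrite eq_le; apply/andP; split; last first.
    by apply: ge_ereal_sup => _ [U [_ AU] <-]; apply: lesum => j _; exact: AU.
  pose K := [set x j | j in [set` s]] `&` A.
  apply: (@le_trans _ _ (dirac_sum s K)); last first.
    apply: ereal_sup_ubound; exists K => //; split; last exact: subIsetr.
    by apply: finite_compact; exact: finx.
  by apply: lesum => j js Aj; split => //; exists j.
Qed.

Lemma borel_open (U : set 'rV[R]_n) :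
  open U -> measurable (U : set (Rn_borel R n)).
Proof. by move=> oU; apply: sub_sigma_algebra. Qed.

Lemma borel_closed (U : set 'rV[R]_n) :
  closed U -> measurable (U : set (Rn_borel R n)).
Proof.
move=> cU; rewrite -[U]setCK; apply: (@measurableC _ (Rn_borel R n)).
by apply: borel_open; apply: closed_openC.
Qed.

Lemma continuous_borel (D : set (Rn_borel R n)) (g : 'rV[R]_n -> R) :
  measurable D -> continuous g ->
  measurable_fun D (g : Rn_borel R n -> measurableTypeR R).
Proof.
move=> mD cg.
apply: (measurability _ (RGenOpens.measurableE R)) => //.
move=> _ [_ [a [b ->] <-]]; apply: measurableI => //.
apply: borel_open; apply: open_comp; last exact: interval_open.
by move=> y _; exact: cg.
Qed.

Lemma integral_dirac_sum (s : seq nat) (D : set (Rn_borel R n)) (g : 'rV[R]_n -> R) :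
  measurable D -> continuous g -> (forall j, j \in s -> D (x j)) ->
  (\int[dirac_sum s]_(y in D) (g y)%:E)%E = (\sum_(j <- s) g (x j))%:E.
Proof.
move=> mD cg Dx.
have mg : measurable_fun D (EFin \o g : Rn_borel R n -> \bar R).
  by apply/measurable_EFinP; exact: continuous_borel.
(* Integration against a sum of measures splits for nonnegative integrands, so the formula is first
   proved for these, then applied to the positive and negative parts of [g]. *)
have ge0E (h : Rn_borel R n -> \bar R) : measurable_fun D h ->
    (forall y, D y -> 0 <= h y)%E ->
    (\int[dirac_sum s]_(y in D) h y = \sum_(j <- s) h (x j))%E.
  move=> mh h0; rewrite ge0_integral_measure_sum//.
  rewrite [RHS](big_nth 0%N) big_mkord.
  apply: eq_bigr => k _; rewrite integral_dirac// diracE mem_set ?mul1e//.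
  exact/Dx/mem_nth.
rewrite integralE !ge0E//; last first.
  exact: measurable_funepos.
  exact: measurable_funeneg.
rewrite -sumEFin.
under eq_bigr do rewrite funeposE/=.
under [X in (_ - X)%E]eq_bigr do rewrite funenegE/=.
under eq_bigr do rewrite -EFin_max.
under [X in (_ - X)%E]eq_bigr do rewrite -EFin_max.
rewrite !sumEFin -EFinB -sumrB; congr EFin.
by apply: eq_bigr => j _; rewrite /Num.max; case: ltP => ?; case: ltP => ?; lra.
Qed.

End finite_dirac_sums.

(** * Finite differences *)

Definition fdiff {R : zmodType} (h : R) (phi : R -> R) (t : R) : R := phi (t + h) - phi t.

(* The nodes, with multiplicity, of the positive and of the negative terms in
   the expansion of the [m]-th finite difference. *)
Fixpoint diff_nodes (m : nat) : seq nat * seq nat :=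
  if m is m'.+1 then
    let: (p, q) := diff_nodes m' in (map S p ++ q, map S q ++ p)
  else ([:: 0%N], [::]).

Lemma iter_fdiffE {R : nzRingType} (m : nat) (h : R) (phi : R -> R) (t : R) :
  iter m (fdiff h) phi t =
    \sum_(j <- (diff_nodes m).1) phi (t + j%:R * h)
    - \sum_(j <- (diff_nodes m).2) phi (t + j%:R * h).
Proof.
elim: m t => [|m IH] t /=; first by rewrite big_seq1 big_nil mul0r addr0 subr0.
rewrite /fdiff !IH; case: (diff_nodes m) => p q /=.
have shift (s : seq nat) :
    \sum_(j <- s) phi (t + h + j%:R * h) = \sum_(j <- map S s) phi (t + j%:R * h).
  by rewrite big_map; apply: eq_bigr => j _; rewrite mulrSr mulrDl mul1r -addrA [h + _]addrC.
by rewrite !big_cat !shift/= opprB addrACA -opprD.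
Qed.

(** The strict bound on the negative nodes matters: with [diff_nodes_top] it shows that node [m]
    occurs with positive sign only. *)
Lemma diff_nodes_le (m j : nat) :
  (j \in (diff_nodes m).1 -> (j <= m)%N) /\ (j \in (diff_nodes m).2 -> (j < m)%N).
Proof.
elim: m j => [|m IH] j /=; first by rewrite inE; split => // /eqP ->.
case: (diff_nodes m) IH => p q /= IH.
rewrite !mem_cat; split => /orP[/mapP[i im ->]|jm].
- by rewrite ltnS; apply: (IH i).1.
- by apply/ltnW/leqW/(IH j).2.
- by rewrite ltnS; apply: (IH i).2.
- by rewrite ltnS; apply: (IH j).1.
Qed.

Lemma diff_nodes_top (m : nat) : m \in (diff_nodes m).1.
Proof.
elim: m => [|m IH] /=; first by rewrite inE.
by case: (diff_nodes m) IH => p q /= IH; rewrite mem_cat map_f.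
Qed.

Lemma continuous_row_mul {R : realType} (n : nat) (w : 'cV[R]_n) :
  continuous (fun x : 'rV[R]_n => (x *m w) 0 0).
Proof.
rewrite (_ : (fun _ => _) = fun x : 'rV[R]_n => \sum_(i < n) x 0 i * w i 0).
  apply: continuous_big => [|i _]; first exact: add_continuous.
  move=> x; apply: continuousM; last exact: cst_continuous.
  exact: coord_continuous.
by apply/funext => x; rewrite mxE.
Qed.

Lemma cube_compact {R : realType} (n : nat) : compact (@cube R n).
Proof.
have /(_ (fun=> segment_compact (a := 0) (b := 1))) := @rV_compact R n (fun=> `[0, 1]%classic).
congr compact; apply/seteqP; split => x /= cx i; have := cx i; rewrite /= ?in_itv//.
Qed.

(** If all [m]-th differences vanished, the Dirac sums over the positive and the negative nodes,
    laid out along an edge of the cube, would integrate every ridge function of [sigma] equally.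
    They would then coincide, but only the first one charges node [m]. *)
Lemma discriminatory_fdiff_neq0 {R : realType} (n : nat) (sigma : R -> R) :
  (0 < n)%N -> continuous sigma -> discriminatory n sigma ->
  forall m, exists h theta, iter m (fdiff h) sigma theta != 0.
Proof.
case: n => // n _ csigma discr m; apply: contrapT => nex.
have fdiff0 h theta : iter m (fdiff h) sigma theta = 0.
  by apply: contrapT => /eqP ne; apply: nex; exists h, theta.
(* The denominator [m.+1] keeps the nodes up to [m] in the cube and is nonzero even for [m = 0]. *)
pose x (j : nat) : 'rV[R]_n.+1 := (j%:R / m.+1%:R) *: delta_mx 0 0.
have xcube j : (j <= m)%N -> cube n.+1 (x j).
  move=> jm i; rewrite !mxE eqxx/=; case: eqP => _; last by rewrite mulr0 lexx ler01.
  by rewrite mulr1 divr_ge0// ler_pdivrMr// mul1r ler_nat ltnW.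
have le1 j : j \in (diff_nodes m).1 -> (j <= m)%N by apply: (diff_nodes_le m j).1.
have le2 j : j \in (diff_nodes m).2 -> (j < m)%N by apply: (diff_nodes_le m j).2.
have conc s : (forall j, j \in s -> (j <= m)%N) -> dirac_sum x s (~` cube n.+1) = 0%E.
  move=> sm; rewrite dirac_sumE big_seq big1// => j /sm/xcube xj.
  by rewrite memNset//=; apply.
have mcube : measurable (cube n.+1 : set (Rn_borel R n.+1)).
  by apply: borel_closed; apply: compact_closed; [exact: norm_hausdorff|exact: cube_compact].
have intE (w : 'cV[R]_n.+1) (theta : R) :
    (\int[dirac_sum x (diff_nodes m).1]_(y in cube n.+1) (sigma ((y *m w) 0 0 + theta))%:E
     = \int[dirac_sum x (diff_nodes m).2]_(y in cube n.+1)
         (sigma ((y *m w) 0 0 + theta))%:E)%E.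
  have cg : continuous (fun y : 'rV[R]_n.+1 => sigma ((y *m w) 0 0 + theta)).
    move=> y; apply: (@continuous_comp _ _ _ (fun y : 'rV[R]_n.+1 => (y *m w) 0 0 + theta) sigma).
      by apply: continuousD; [exact: continuous_row_mul|exact: cst_continuous].
    exact: csigma.
  rewrite !integral_dirac_sum//; last 2 first.
    by move=> j /le2/ltnW/xcube.
    by move=> j /le1/xcube.
  have := fdiff0 (w 0 0 / m.+1%:R) theta; rewrite iter_fdiffE => /subr0_eq.
  have xw j : sigma ((x j *m w) 0 0 + theta) = sigma (theta + j%:R * (w 0 0 / m.+1%:R)).
    by rewrite /x -scalemxAl -rowE !mxE addrC; congr (sigma (_ + _)); ring.
  by under eq_bigr do rewrite -xw; under [RHS]eq_bigr do rewrite -xw; move=> ->.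
have xinj j : x j = x m -> j = m.
  move=> /matrixP/(_ 0 0); rewrite !mxE eqxx !mulr1 => /(congr1 ( *%R^~ m.+1%:R)).
  by rewrite !divfK ?pnatr_eq0// => /eqP; rewrite eqr_nat => /eqP.
have mtop : measurable ([set x m] : set (Rn_borel R n.+1)).
  by apply: borel_closed; exact: finite_closed.
have dne := discr (dirac_sum x (diff_nodes m).1) (dirac_sum x (diff_nodes m).2)
  (conc _ le1) (conc _ (fun j js => ltnW (le2 j js)))
  (dirac_sum_regular _ _) (dirac_sum_regular _ _) intE _ mtop.
have neg0 : (dirac_sum x (diff_nodes m).2 [set x m] = 0)%E.
  rewrite dirac_sumE big_seq big1// => j /le2 jm; rewrite memNset//= => /xinj jE.
  by rewrite jE ltnn in jm.
have pos0 : dirac_sum x (diff_nodes m).1 [set x m] = 0%E := etrans dne neg0.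
suff : (0%E < dirac_sum x (diff_nodes m).1 [set x m])%E by rewrite pos0 ltxx.
rewrite dirac_sumE lte_fin (big_rem m) ?diff_nodes_top//= mem_set// ltr_pwDl//.
by apply: sumr_ge0.
Qed.

(** * Primitives *)

(** Halving a radius of continuity at a point gives a radius valid for all nearby centres;
    compactness, as a near-covering property, then yields one radius for all of [K]. *)
Lemma compact_uniform_continuity {R : realType} {T : pseudoMetricType R} (K : set T)
    (f : T -> R) :
  compact K -> {within K, continuous f} -> forall e, 0 < e ->
  exists2 d, 0 < d & forall x y, K x -> K y -> ball x d y -> `|f x - f y| < e.
Proof.
move=> /compact_near_coveringP/near_covering_withinP cK cf e e0.
pose P (d : R) (x : T) := forall y, K y -> ball x d y -> `|f x - f y| < e.
have /cK cov x : K x -> \forall x' \near x & d \near 0^'+, K x' -> P d x'.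
  move=> Kx; move/subspace_continuousP : cf => /(_ x Kx)/cvgrPdist_lt.
  move=> /(_ (e / 2)); rewrite divr_gt0// => /(_ isT) /nbhs_ballP[r /= r0 xr].
  have r2 : 0 < r / 2 by rewrite divr_gt0.
  exists (ball x (r / 2), [set d | d < r / 2]).
    by split => /=; [exact: nbhsx_ballx|exact: nbhs_right_lt].
  move=> [x' d] /= [xx' dr] Kx' y Ky x'y.
  have r2r : r / 2 <= r by lra.
  have /= fx' := xr x' (le_ball r2r xx') Kx'.
  have /= fy := xr y (ball_splitr (ball_sym xx') (le_ball (ltW dr) x'y)) Ky.
  rewrite -[f x'](subrK (f x)) -addrA; apply: le_lt_trans (ler_normD _ _) _.
  by rewrite distrC [ltRHS]splitr ltrD.
have : \forall d \near 0^'+, 0 < d /\ K `<=` P d.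
  by near=> d; split; near: d; [exact: nbhs_right_gt|exact: cov].
move=> /filter_ex[d [d0 KP]]; exists d => // x y Kx; exact: KP.
Unshelve. all: end_near. Qed.

Section primitives.
Context {R : realType}.
Implicit Types f g F : R -> R.

Definition primitive f F := forall t : R, is_derive t 1 F (f t).

Lemma primitive_continuous f F : primitive f F -> continuous F.
Proof.
move=> Ff t; apply: differentiable_continuous; apply/derivable1_diffP.
by have [] := Ff t.
Qed.

Lemma mvt_le f F (x y : R) : (forall t, x <= t <= y -> is_derive t 1 F (f t)) ->
  x <= y -> exists2 c, x <= c <= y & F y - F x = f c * (y - x).
Proof.
move=> Ff xy.
have Fd t : t \in `]x, y[ -> is_derive t 1 F (f t).
  by rewrite in_itv/= => /andP[/ltW xt /ltW ty]; apply: Ff; rewrite xt.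
have Fc : {within `[x, y], continuous F}.
  apply: derivable_within_continuous => t; rewrite in_itv/= => txy.
  by have [] := Ff t txy.
have [c] := MVT_segment xy Fd Fc.
by rewrite in_itv/= => cxy E; exists c.
Qed.

(** Locating [c] by its distance to [x] covers both orders of the end points, as needed for
    increments of either sign. *)
Lemma mvt f F (x y : R) : primitive f F ->
  exists2 c, `|c - x| <= `|y - x| & F y - F x = f c * (y - x).
Proof.
move=> Ff; have [xy|/ltW yx] := leP x y.
  have [c /andP[xc cy] E] := mvt_le (fun t _ => Ff t) xy.
  by exists c => //; rewrite !ger0_norm ?subr_ge0//; lra.
have [c /andP[xc cy] E] := mvt_le (fun t _ => Ff t) yx.
exists c; first by rewrite !ler0_norm ?subr_le0//; lra.
by rewrite -opprB E -mulrN opprB.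
Qed.

Lemma primitive_ray f (c : R) : continuous f ->
  exists F, forall t, c < t -> is_derive t 1 F (f t).
Proof.
move=> cf.
exists (fun x => \int[lebesgue_measure]_(t in `[c, x]) (f t))%R => t ct.
have tt1 : t < t + 1 by rewrite ltrDl.
have intf : lebesgue_measure.-integrable `[c, t + 1] (EFin \o f).
  apply: continuous_compact_integrable; first exact: segment_compact.
  exact: continuous_subspaceT.
have [dF Fe] := continuous_FTC1_closed tt1 intf ct (cf t).
by apply: DeriveDef => //; rewrite -derive1E.
Qed.

(** An integral from a fixed base point gives a primitive on a ray only. Primitives on the rays from
    [- N], normalised at 0, agree on overlaps by the mean value theorem and can be glued. *)
Lemma exists_primitive f : continuous f -> exists F, primitive f F.
Proof.
move=> cf.
have /choice[G GP] (N : nat) : exists F : R -> R, F 0 = 0 /\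
    forall t : R, - N%:R < t -> is_derive t 1 F (f t).
  have [F FP] := primitive_ray (- N%:R) cf.
  exists (F - cst (F 0)); split => [|t Nt]; first by rewrite !fctE subrr.
  have := FP t Nt => ?; rewrite -[f t]subr0; exact: is_deriveB.
have GE (N M : nat) (t : R) : - N%:R < t -> - M%:R < t -> (0 < N)%N -> (0 < M)%N -> G N t = G M t.
  move=> Nt Mt N0 M0.
  have N0' : 0 < N%:R :> R by rewrite ltr0n.
  have M0' : 0 < M%:R :> R by rewrite ltr0n.
  have GG (s : R) : - N%:R < s -> - M%:R < s -> is_derive s 1 (G N - G M) ((fun=> 0) s).
    by move=> Ns Ms; rewrite -[X in is_derive _ _ _ X](subrr (f s)); apply: is_deriveB;
      [exact: (GP N).2|exact: (GP M).2].
  suff : (G N - G M) t = 0 by move=> /subr0_eq.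
  have D0 : (G N - G M) 0 = 0 by rewrite !fctE (GP N).1 (GP M).1 subr0.
  have [t0|/ltW t0] := leP 0 t.
    have [|c _] := @mvt_le (fun=> 0) (G N - G M) 0 t _ t0.
      by move=> s /andP[s0 st]; apply: GG; lra.
    by rewrite mul0r D0 subr0.
  have [|c _] := @mvt_le (fun=> 0) (G N - G M) t 0 _ t0.
    by move=> s /andP[s0 st]; apply: GG; lra.
  by rewrite mul0r D0 sub0r => /eqP; rewrite oppr_eq0 => /eqP.
pose N (t : R) := (Num.truncn `|t|).+1.
have Nlt t : - (N t)%:R < t.
  by have := truncnS_gt `|t|; rewrite -/(N t) => tN; have := ler_norm (- t); rewrite normrN; lra.
exists (fun t => G (N t) t) => t.
(* Points within distance 1 of [t] all lie in the ray of index [(N t).+1], so near [t] the glued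
   function is a single primitive. *)
apply: (@near_eq_is_derive _ _ _ (G (N t).+1)); last first.
  by apply: (GP _).2; rewrite -natr1; have := Nlt t; lra.
near=> s; apply: GE => //.
have := truncnS_gt `|t|; rewrite -/(N t) -natr1 => tN.
have : `|t - s| < 1 by near: s; exact: cvgr_dist_lt.
have := ler_norm (- t); rewrite normrN => tt.
by have := ler_norm (t - s); lra.
Unshelve. all: end_near. Qed.

End primitives.

(** * Iterated differences of primitives and Taylor expansions *)

Section finite_differences.
Context {R : realType}.
Implicit Types f g F G : R -> R.

Lemma primitive_shift f F (c : R) : primitive f F ->
  primitive (fun t => f (t + c)) (fun t => F (t + c)).
Proof.
move=> Ff t; rewrite -[f _]mulr1.
by apply: (@is_derive1_comp _ F (shift c)); [exact: Ff|exact: is_derive_shift].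
Qed.

Lemma primitiveB f g F G : primitive f F -> primitive g G ->
  primitive (fun t => f t - g t) (fun t => F t - G t).
Proof. by move=> Ff Gg t; exact: (is_deriveB (Ff t) (Gg t)). Qed.

Lemma primitive_iter_fdiff (m : nat) (h : R) f F : primitive f F ->
  primitive (iter m (fdiff h) f) (iter m (fdiff h) F).
Proof.
by move=> Ff; elim: m => //= m IH; apply: primitiveB => //; exact: primitive_shift.
Qed.

Lemma continuous_iter_fdiff (m : nat) (h : R) f : continuous f ->
  continuous (iter m (fdiff h) f).
Proof.
move=> cf; elim: m => //= m IH t; apply: cvgB; last exact: IH.
apply: (@continuous_comp _ _ _ (shift h)); last exact: IH.
by apply: cvgD; [exact: cvg_id|exact: cvg_cst].
Qed.

Lemma primitive_chain (m : nat) f : continuous f ->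
  exists Phi : nat -> R -> R,
    Phi 0%N = f /\ forall j, (j < m)%N -> primitive (Phi j) (Phi j.+1).
Proof.
elim: m f => [|m IH] f cf; first by exists (fun=> f).
have [F Ff] := exists_primitive cf.
have [Phi [Phi0 PhiP]] := IH F (primitive_continuous Ff).
exists (fun j => if j is i.+1 then Phi i else f); split=> // -[|j] /=.
  by rewrite Phi0.
by rewrite ltnS; exact: PhiP.
Qed.

(* [p] is a Taylor polynomial of [g] at [b], of degree exactly [j]. *)
Definition peano (j : nat) g (b : R) (p : {poly R}) : Prop :=
  [/\ (size p <= j.+1)%N, p`_j != 0 &
    forall e, 0 < e -> exists2 d, 0 < d & forall s, `|s| <= d ->
      `|g (b + s) - p.[s]| <= e * `|s| ^+ j].

Lemma peano0 g (b : R) : continuous g -> g b != 0 -> peano 0 g b (g b)%:P.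
Proof.
move=> cg gb; split; [exact: size_polyC_leq1|by rewrite coefC|move=> e e0].
have := cg b; move/cvgrPdist_lt => /(_ e e0)/nbhs_ballP[r /= r0 br].
exists (r / 2); first by rewrite divr_gt0.
move=> s sr; rewrite hornerC expr0 mulr1 distrC ltW//; apply: br.
by rewrite /ball/= opprD addNKr normrN; lra.
Qed.

(** Integrating [p] termwise with constant term [G b] makes [G (s + b) - P.[s]] vanish at 0. Its
    derivative is the old remainder, so the mean value theorem gains one factor [|s|]. *)
Lemma peano_primitive (j : nat) g G (b : R) (p : {poly R}) : primitive g G ->
  peano j g b p -> exists P, peano j.+1 G b P.
Proof.
move=> Gg [sp pj0 rem].
pose P := \poly_(i < j.+2) (if i is k.+1 then p`_k / k.+1%:R else G b).
have dP : P^`() = p.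
  apply/polyP => i; rewrite coef_deriv coef_poly ltnS.
  case: ltnP => ij; first by rewrite -[LHS]mulr_natr divfK// pnatr_eq0.
  by rewrite mul0rn nth_default// (leq_trans sp).
exists P; split; first exact: size_poly.
  by rewrite coef_poly ltnSn mulf_neq0// invr_neq0// pnatr_eq0.
move=> e e0; have [d d0 dH] := rem e e0; exists d => // s sd.
have DP : primitive (fun s => g (s + b) - p.[s]) (fun s => G (s + b) - P.[s]).
  by rewrite -{1}dP; apply: primitiveB; [exact: primitive_shift|exact: is_derive_poly].
have [c] := mvt 0 s DP; rewrite !subr0 add0r horner_coef0 coef_poly/= subrr subr0.
move=> cs; rewrite [s + b]addrC => ->; rewrite normrM exprSr mulrA ler_wpM2r//.
rewrite [c + b]addrC; apply: le_trans (dH c (le_trans cs sd)) _.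
by rewrite ler_wpM2l ?(ltW e0)// lerXn2r ?nnegrE.
Qed.

End finite_differences.

(** * Uniform approximation by networks *)

Section approximation.
Context {R : realType} {n : nat} (sigma : R -> R).
Implicit Types (f g : 'rV[R]_n -> R) (w : 'cV[R]_n) (b : R) (phi psi : R -> R).

Definition affine w b (x : 'rV[R]_n) : R := (x *m w) 0 0 + b.

Definition network (s : seq ('cV[R]_n * R * R)) (x : 'rV[R]_n) : R :=
  \sum_(p <- s) p.2 * sigma (affine p.1.1 p.1.2 x).

Definition approximable f := forall e, 0 < e ->
  exists s, forall x, cube n x -> `|network s x - f x| < e.

Lemma approximable_lim f :
  (forall e, 0 < e -> exists2 g, approximable g &
     forall x, cube n x -> `|g x - f x| < e) -> approximable f.
Proof.
move=> fg e e0; have e2 : 0 < e / 2 by rewrite divr_gt0.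
have [g /(_ _ e2)[s sg] gf] := fg _ e2; exists s => x cx.
rewrite -[network s x](subrK (g x)) -addrA; apply: le_lt_trans (ler_normD _ _) _.
by rewrite [ltRHS]splitr ltrD ?sg ?gf.
Qed.

Lemma eq_approximable f g : (forall x, f x = g x) -> approximable f -> approximable g.
Proof. by move=> /funext ->. Qed.

Lemma approximable0 : approximable (fun=> 0).
Proof. by move=> e e0; exists [::] => x _; rewrite /network big_nil subr0 normr0. Qed.

Lemma approximableD f g :
  approximable f -> approximable g -> approximable (fun x => f x + g x).
Proof.
move=> fa ga e e0; have e2 : 0 < e / 2 by rewrite divr_gt0.
have [s sf] := fa _ e2; have [t tg] := ga _ e2; exists (s ++ t) => x cx.
rewrite /network big_cat/= opprD addrACA; apply: le_lt_trans (ler_normD _ _) _.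
by rewrite [ltRHS]splitr ltrD ?sf ?tg.
Qed.

Lemma approximableZ (c : R) f : approximable f -> approximable (fun x => c * f x).
Proof.
move=> fa e e0; have c1 : 0 < `|c| + 1 by rewrite ltr_wpDl.
have [s sf] := fa (e / (`|c| + 1)) (divr_gt0 e0 c1).
exists [seq (p.1, c * p.2) | p <- s] => x cx.
rewrite /network big_map/=; under eq_bigr do rewrite -mulrA.
rewrite -mulr_sumr -mulrBr normrM.
apply: (@le_lt_trans _ _ (`|c| * (e / (`|c| + 1)))).
  by rewrite ler_wpM2l// ltW// sf.
by rewrite mulrCA gtr_pMr// ltr_pdivrMr// mul1r ltrDl.
Qed.

Lemma approximable_sum (I : Type) (r : seq I) (F : I -> 'rV[R]_n -> R) :
  (forall i, approximable (F i)) -> approximable (fun x => \sum_(i <- r) F i x).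
Proof.
move=> Fa; elim: r => [|i r IH].
  by apply: eq_approximable approximable0 => x; rewrite big_nil.
by apply: eq_approximable (approximableD (Fa i) IH) => x; rewrite big_cons.
Qed.

(** Quantifying over all affine forms makes this class of one-variable functions stable under affine
    substitutions. *)
Definition ridge_approximable phi :=
  forall w b, approximable (fun x => phi (affine w b x)).

Lemma ridge_sigma : ridge_approximable sigma.
Proof.
move=> w b e e0; exists [:: (w, b, 1)] => x _.
by rewrite /network big_seq1/= mul1r subrr normr0.
Qed.

Lemma affine_bounded w b : exists2 K, 0 <= K & forall x, cube n x -> `|affine w b x| <= K.
Proof.
exists (\sum_i `|w i 0| + `|b|); first by rewrite addr_ge0// sumr_ge0.
move=> x cx; apply: le_trans (ler_normD _ _) _; rewrite lerD2r mxE.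
apply: le_trans (ler_norm_sum _ _ _) _; apply: ler_sum => i _.
have /andP[x0 x1] := cx i.
by rewrite normrM ler_piMl// ger0_norm.
Qed.

(** Affine forms are bounded on the cube, so uniform convergence on bounded intervals suffices. *)
Lemma ridge_lim phi :
  (forall K e, 0 <= K -> 0 < e -> exists2 psi, ridge_approximable psi &
     forall t, `|t| <= K -> `|psi t - phi t| < e) -> ridge_approximable phi.
Proof.
move=> H w b; apply: approximable_lim => e e0.
have [K K0 xK] := affine_bounded w b; have [psi psia psiphi] := H K e K0 e0.
by exists (fun x => psi (affine w b x)) => // x /xK/psiphi.
Qed.

Lemma eq_ridge phi psi : (forall t, phi t = psi t) ->
  ridge_approximable phi -> ridge_approximable psi.
Proof. by move=> /funext ->. Qed.

Lemma ridgeD phi psi : ridge_approximable phi -> ridge_approximable psi ->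
  ridge_approximable (fun t => phi t + psi t).
Proof. by move=> A B w b; exact: approximableD. Qed.

Lemma ridgeZ (c : R) phi : ridge_approximable phi ->
  ridge_approximable (fun t => c * phi t).
Proof. by move=> A w b; exact: approximableZ. Qed.

Lemma ridge_sum (I : Type) (r : seq I) (F : I -> R -> R) :
  (forall i, ridge_approximable (F i)) ->
  ridge_approximable (fun t => \sum_(i <- r) F i t).
Proof. by move=> Fa w b; apply: approximable_sum => i; exact: Fa. Qed.

Lemma ridge_affine (a c : R) phi : ridge_approximable phi ->
  ridge_approximable (fun t => phi (a * t + c)).
Proof.
move=> A w b; apply: eq_approximable (A (a *: w) (a * b + c)) => x.
by rewrite /affine -scalemxAr mxE addrA mulrDr.
Qed.

(** The increment of [Psi] is the integral of [psi] from [t] to [t + h]; its Riemann sums of step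
    [eta] are combinations of translates of [psi]. *)
Lemma ridge_fdiff_primitive (h : R) psi (Psi : R -> R) :
  continuous psi -> primitive psi Psi -> ridge_approximable psi ->
  ridge_approximable (fdiff h Psi).
Proof.
move=> cpsi PsiP psia; apply: ridge_lim => K e K0 e0.
(* One [|h|] is for the grid points [t + i%:R * eta], the other for the mean value points. *)
pose K' := K + 2 * `|h|.
have h1 : 0 < `|h| + 1 by rewrite ltr_wpDl.
have [d d0 unif] := compact_uniform_continuity (@segment_compact R (- K') K')
  (continuous_subspaceT cpsi) (divr_gt0 e0 h1).
pose N := (Num.truncn (`|h| / d)).+1.
have N0 : 0 < N%:R :> R by rewrite ltr0n.
pose eta := h / N%:R.
have etah : `|eta| <= `|h|.
  by rewrite /eta normrM normfV [`|N%:R|]ger0_norm// ler_pdivrMr// ler_peMr// ler1n.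
have etad : `|eta| < d.
  rewrite /eta normrM normfV [`|N%:R|]ger0_norm// ltr_pdivrMr// mulrC -ltr_pdivrMr//.
  exact: truncnS_gt.
exists (fun t => eta * \sum_(i < N) psi (t + i%:R * eta)).
  apply: ridgeZ; apply: ridge_sum => i.
  by apply: eq_ridge (ridge_affine 1 (i%:R * eta) psia) => t; rewrite mul1r.
move=> t tK.
have -> : fdiff h Psi t = \sum_(i < N) (Psi (t + i.+1%:R * eta) - Psi (t + i%:R * eta)).
  rewrite -(big_mkord xpredT (fun i => Psi (t + i.+1%:R * eta) - Psi (t + i%:R * eta))).
  rewrite telescope_sumr// mul0r addr0 /fdiff /eta.
  by rewrite mulrC divfK// gt_eqF.
rewrite mulr_sumr -sumrB; apply: le_lt_trans (ler_norm_sum _ _ _) _.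
apply: (@le_lt_trans _ _ (\sum_(i < N) `|eta| * (e / (`|h| + 1)))).
  apply: ler_sum => i _; have [c cle ->] := mvt (t + i%:R * eta) (t + i.+1%:R * eta) PsiP.
  have dE : t + i.+1%:R * eta - (t + i%:R * eta) = eta by rewrite -natr1; ring.
  rewrite dE in cle *; rewrite [psi c * _]mulrC -mulrBr normrM ler_wpM2l// ltW//.
  have ih : `|i%:R * eta| <= `|h|.
    rewrite /eta mulrCA normrM ler_piMr// normrM normfV !ger0_norm//.
    by rewrite ler_pdivrMr// mul1r ler_nat ltnW.
  have tb : `|t + i%:R * eta| <= K + `|h| by apply: le_trans (ler_normD _ _) _; exact: lerD.
  apply: unif.
  - by rewrite /= in_itv/= -ler_norml /K'; apply: le_trans tb _; have := normr_ge0 h; lra.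
  - rewrite /= in_itv/= -ler_norml -[c](subrK (t + i%:R * eta)).
    by apply: le_trans (ler_normD _ _) _; rewrite /K'; lra.
  - by rewrite /ball/= distrC; apply: le_lt_trans cle _.
have -> : \sum_(i < N) `|eta| * (e / (`|h| + 1)) = `|h| * (e / (`|h| + 1)).
  rewrite sumr_const card_ord -mulr_natl mulrA /eta normrM normfV [`|N%:R|]ger0_norm//.
  by rewrite [N%:R * _]mulrC divfK// gt_eqF.
by rewrite mulrCA gtr_pMr// ltr_pdivrMr// mul1r ltrDl.
Qed.

(** Subtracting the lower Taylor terms from [G (eta * t + b)] and dividing by the leading
    coefficient times [eta ^+ m] leaves [t ^+ m] up to an error that is small with [eta]. *)
Lemma ridge_monomial_of_peano (m : nat) (G : R -> R) (b : R) (p : {poly R}) :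
  (forall k, (k < m)%N -> ridge_approximable (fun t => t ^+ k)) ->
  ridge_approximable G -> peano m G b p -> ridge_approximable (fun t => t ^+ m).
Proof.
move=> low Ga [sp pm0 rem]; apply: ridge_lim => K e K0 e0.
have K1 : 0 < K + 1 by rewrite ltr_wpDl.
(* The division amplifies the remainder by at most [(K + 1) ^+ m] over the modulus of the leading
   coefficient; the factor 2 makes the final bound strict. *)
have eps0 : 0 < e * `|p`_m| / (K + 1) ^+ m / 2.
  by rewrite !divr_gt0 ?mulr_gt0 ?normr_gt0 ?exprn_gt0.
have [d d0 dP] := rem _ eps0.
have [eta eta0 etaK] : exists2 eta, 0 < eta & eta * (K + 1) = d.
  by exists (d / (K + 1)); rewrite ?divr_gt0// divfK// gt_eqF.
exists (fun t => (p`_m * eta ^+ m)^-1 *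
    (G (eta * t + b) + \sum_(k < m) (- p`_k * eta ^+ k) * t ^+ k)).
  apply: ridgeZ; apply: ridgeD; first exact: (ridge_affine eta b Ga).
  by apply: ridge_sum => k; apply: ridgeZ; exact: low.
move=> t tK.
have nz : p`_m * eta ^+ m != 0 by rewrite mulf_neq0// expf_neq0// gt_eqF.
have tK1 : `|t| <= K + 1 by lra.
have etat : `|eta * t| <= d.
  by rewrite normrM gtr0_norm// -etaK ler_pM2l.
have := dP _ etat; rewrite (horner_coef_wide _ sp) big_ord_recr/=.
set S := \sum_(i < m) _.
have -> : \sum_(k < m) (- p`_k * eta ^+ k) * t ^+ k = - S.
  by rewrite /S -sumrN; apply: eq_bigr => k _; rewrite exprMn !mulNr mulrA.
rewrite [b + eta * t]addrC => H.
have -> : (p`_m * eta ^+ m)^-1 * (G (eta * t + b) - S) - t ^+ m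
    = (p`_m * eta ^+ m)^-1 * (G (eta * t + b) - (S + p`_m * (eta * t) ^+ m)).
  by rewrite opprD addrA [RHS]mulrBr exprMn [X in _ = _ - _ * X]mulrA mulKf.
rewrite normrM normfV mulrC ltr_pdivrMr ?normr_gt0//.
apply: le_lt_trans H _; rewrite [`|p`_m * _|]normrM [`|eta ^+ m|]gtr0_norm ?exprn_gt0//.
rewrite normrM exprMn gtr0_norm//.
have tm : `|t| ^+ m <= (K + 1) ^+ m by rewrite lerXn2r// nnegrE// ltW.
set X := (K + 1) ^+ m in tm *; set A := `|p`_m|; set E := eta ^+ m.
have X0 : 0 < X by rewrite exprn_gt0.
have AE0 : 0 < e * A * E by rewrite !mulr_gt0 ?normr_gt0 ?exprn_gt0.
have -> : e * A / X / 2 * (E * `|t| ^+ m) = e * A * E * (`|t| ^+ m / X / 2) by ring.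
by rewrite [ltRHS]mulrA gtr_pMr// ltr_pdivrMr// mul1r; apply: le_lt_trans (_ : 1 < 2);
  rewrite ?ler_pdivrMr ?mul1r// ltr1n.
Qed.

Lemma ridge_monomial (m : nat) : continuous sigma ->
  (forall k, exists h theta, iter k (fdiff h) sigma theta != 0) ->
  ridge_approximable (fun t => t ^+ m).
Proof.
move=> csigma nz; elim/ltn_ind: m => m IH.
have [h [theta hnz]] := nz m.
have [Phi [Phi0 PhiP]] := primitive_chain m csigma.
have Phic j : (j <= m)%N -> continuous (Phi j).
  case: j => [_|j jm]; first by rewrite Phi0.
  exact: primitive_continuous (PhiP j jm).
(* Differences and primitives grow together here: each step takes one difference of a primitive of
   the previous function. *)
have Ga j : (j <= m)%N -> ridge_approximable (iter j (fdiff h) (Phi j)).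
  elim: j => [_|j IHj jm]; first by rewrite Phi0; exact: ridge_sigma.
  apply: ridge_fdiff_primitive (IHj (ltnW jm)).
    exact/continuous_iter_fdiff/Phic/ltnW.
  exact/primitive_iter_fdiff/PhiP.
have [p pP] : exists p, peano m (iter m (fdiff h) (Phi m)) theta p.
  (* Here the number of differences stays [m]: one starts from the nonzero value at [theta] of the
     difference of [sigma], and each integration raises the degree by one. *)
  have : forall j, (j <= m)%N -> exists p, peano j (iter m (fdiff h) (Phi j)) theta p.
    elim=> [_|j IHj jm].
      exists (iter m (fdiff h) (Phi 0%N) theta)%:P; apply: peano0.
        exact/continuous_iter_fdiff/Phic.
      by rewrite Phi0.
    have [p pP] := IHj (ltnW jm).
    by apply: peano_primitive pP; exact/primitive_iter_fdiff/PhiP.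
  exact.
exact: ridge_monomial_of_peano IH (Ga m (leqnn m)) pP.
Qed.

End approximation.

(** * From ridge monomials to products of affine forms *)

Section products.
Context {R : realType} {n : nat} (sigma : R -> R).
Hypothesis monomial : forall k, @ridge_approximable R n sigma (fun t => t ^+ k).

(** Raising the exponent multiplies the remainder by [y + t * z], bounded by [Y + Z] since
    [|t| <= 1], and adds a term of order [t ^+ 2]. The constant is thus uniform in [y] and [z]. *)
Lemma exprD_first_order (a : nat) (Y Z : R) : 0 <= Y -> 0 <= Z ->
  exists2 C, 0 <= C & forall y z t, `|y| <= Y -> `|z| <= Z -> `|t| <= 1 ->
    `|(y + t * z) ^+ a.+1 - y ^+ a.+1 - a.+1%:R * t * y ^+ a * z| <= C * t ^+ 2.
Proof.
move=> Y0 Z0; elim: a => [|a [C C0 IH]].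
  exists 0 => // y z t _ _ _; rewrite (_ : _ - _ - _ = 0) ?normr0 ?mul0r//.
  by rewrite !expr1 expr0; ring.
exists ((Y + Z) * C + Z ^+ 2 * a.+1%:R * Y ^+ a).
  by rewrite addr_ge0 ?mulr_ge0 ?addr_ge0 ?exprn_ge0.
move=> y z t yY zZ t1.
have -> : (y + t * z) ^+ a.+2 - y ^+ a.+2 - a.+2%:R * t * y ^+ a.+1 * z =
    (y + t * z) * ((y + t * z) ^+ a.+1 - y ^+ a.+1 - a.+1%:R * t * y ^+ a * z)
    + z ^+ 2 * a.+1%:R * y ^+ a * t ^+ 2.
  by rewrite exprS [y ^+ a.+2]exprS [y ^+ a.+1]exprS -[a.+2%:R]natr1; ring.
rewrite [leRHS]mulrDl; apply: le_trans (ler_normD _ _) _; apply: lerD.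
  rewrite normrM -[leRHS]mulrA; apply: ler_pM => //; last exact: IH.
  apply: le_trans (ler_normD _ _) _; rewrite lerD// normrM.
  by apply: le_trans zZ; rewrite ler_piMl.
have -> : t ^+ 2 = `|t| ^+ 2 by rewrite real_normK ?num_real.
rewrite !normrM !normrX normr_nat normr_id ler_wpM2r ?exprn_ge0//.
apply: ler_pM; rewrite ?mulr_ge0 ?exprn_ge0//; last by rewrite lerXn2r ?nnegrE.
by rewrite ler_wpM2r// -expr2 lerXn2r ?nnegrE.
Qed.

Lemma prod_affine_bounded (s : seq ('cV[R]_n * R)) : exists2 M, 0 <= M &
  forall x, cube n x -> `|\prod_(p <- s) affine p.1 p.2 x| <= M.
Proof.
elim: s => [|p s [M M0 IH]]; first by exists 1 => // x _; rewrite big_nil normr1.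
have [K K0 KP] := affine_bounded p.1 p.2.
exists (K * M) => [|x cx]; first exact: mulr_ge0.
by rewrite big_cons normrM ler_pM// ?KP ?IH.
Qed.

(* [y ^+ a * z] is the derivative of [(y + t * z) ^+ a.+1 / a.+1] at [t = 0]. *)
Lemma approximable_expr_prod (s : seq ('cV[R]_n * R)) (a : nat) (w : 'cV[R]_n) (b : R) :
  approximable sigma (fun x => affine w b x ^+ a * \prod_(p <- s) affine p.1 p.2 x).
Proof.
(* The exponent and the form are generalised because absorbing a factor of the product raises the
   one and perturbs the other. *)
elim: s a w b => [|[w' b'] s IH] a w b.
  by apply: eq_approximable (monomial a w b) => x; rewrite big_nil mulr1.
apply: approximable_lim => e e0.
have [Y Y0 YP] := affine_bounded w b.
have [Z Z0 ZP] := affine_bounded w' b'.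
have [M M0 MP] := prod_affine_bounded s.
have [C C0 CP] := exprD_first_order a Y0 Z0.
pose t := e / (C * M + 1 + e).
have den0 : 0 < C * M + 1 + e by rewrite addr_gt0// ltr_wpDl ?mulr_ge0.
have t0 : 0 < t by rewrite divr_gt0.
have t1 : `|t| <= 1.
  by rewrite gtr0_norm// ler_pdivrMr// mul1r lerDr addr_ge0// mulr_ge0.
have CMt : C * M * t < e.
  have -> : C * M * t = e * (C * M / (C * M + 1 + e)) by rewrite /t; ring.
  by rewrite gtr_pMr// ltr_pdivrMr// mul1r -addrA ltrDl addr_gt0.
clearbody t; have a1 : (1 : R) <= a.+1%:R by rewrite ler1n.
(* A difference quotient in the direction [(w', b')], with the remaining product carried along as a
   bounded factor. *)
exists (fun x => (a.+1%:R * t)^-1 *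
    (affine (w + t *: w') (b + t * b') x ^+ a.+1 * \prod_(p <- s) affine p.1 p.2 x
     + -1 * (affine w b x ^+ a.+1 * \prod_(p <- s) affine p.1 p.2 x))).
  by apply: approximableZ; apply: approximableD (IH _ _ _) (approximableZ _ (IH _ _ _)).
move=> x cx; rewrite big_cons/=.
have -> : affine (w + t *: w') (b + t * b') x = affine w b x + t * affine w' b' x.
  by rewrite /affine mulmxDr -scalemxAr !mxE; ring.
move: (YP x cx) (ZP x cx) (MP x cx).
set y := affine w b x; set z := affine w' b' x; set m := \prod_(p <- s) _ => yY zZ mM.
have at0 : a.+1%:R * t != 0 by rewrite mulf_neq0 ?pnatr_eq0// gt_eqF.
have -> : (a.+1%:R * t)^-1 * ((y + t * z) ^+ a.+1 * m + -1 * (y ^+ a.+1 * m))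
      - y ^+ a * (z * m)
    = (a.+1%:R * t)^-1 *
      (((y + t * z) ^+ a.+1 - y ^+ a.+1 - a.+1%:R * t * y ^+ a * z) * m).
  by apply: (mulfI at0); rewrite mulrBr !mulVKf//; ring.
rewrite normrM normfV mulrC ltr_pdivrMr ?normr_gt0// normrM.
rewrite [`|a.+1%:R * t|]ger0_norm ?mulr_ge0 ?ltW//.
apply: (@le_lt_trans _ _ (C * t ^+ 2 * M)).
  by apply: ler_pM => //; exact: CP.
have -> : C * t ^+ 2 * M = C * M * t * t by ring.
rewrite [ltRHS]mulrA ltr_pM2r//; apply: lt_le_trans CMt _.
by rewrite ler_peMr// ltW.
Qed.

Lemma approximable_prod_affine (I : Type) (r : seq I) (w : I -> 'cV[R]_n) (b : I -> R) :
  approximable sigma (fun x => \prod_(i <- r) affine (w i) (b i) x).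
Proof.
apply: eq_approximable (approximable_expr_prod [seq (w i, b i) | i <- r] 0 0 0) => x.
by rewrite expr0 mul1r big_map.
Qed.

End products.

(** * Bernstein polynomials on the cube *)

Section bernstein.
Context {R : realType} {n N : nat}.
Implicit Types (x : 'rV[R]_n) (om : {ffun 'I_n * 'I_N -> bool}).

(* [om] records the outcomes of [N] Bernoulli trials of parameter [x 0 i] for
   each coordinate [i]; [bweight x om] is its probability. *)
Definition bweight x om : R :=
  \prod_p (if om p then x 0 p.1 else 1 - x 0 p.1).

Definition bmean om : 'rV[R]_n := \row_i ((\sum_(j < N) (om (i, j))%:R) / N%:R).

(** This is the tensor-product Bernstein polynomial of degree [N] in each variable. Summing over
    outcomes instead of grouping them with binomial coefficients makes each weight a product of
    affine forms. *)
Definition bernstein (f : 'rV[R]_n -> R) x : R := \sum_om f (bmean om) * bweight x om.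

Lemma bweight_ge0 x om : cube n x -> 0 <= bweight x om.
Proof.
move=> cx; apply: prodr_ge0 => p _; have /andP[x0 x1] := cx p.1.
by case: ifP => // _; rewrite subr_ge0.
Qed.

Lemma bmean_cube om : cube n (bmean om).
Proof.
move=> i; rewrite mxE; have sum0 : 0 <= \sum_(j < N) ((om (i, j))%:R : R) by apply: sumr_ge0.
(* For [N = 0] the inverse is 0 by convention, so the mean is 0. *)
rewrite divr_ge0//=; case: N om sum0 => [|k] om' _; first by rewrite invr0 mulr0.
rewrite ler_pdivrMr// mul1r; apply: (@le_trans _ _ (\sum_(j < k.+1) 1)).
  by apply: ler_sum => j _; rewrite lern1; case: (om' _).
by rewrite sumr_const card_ord.
Qed.

(** Independence of the trials, obtained by distributing the product of two-term sums over all
    outcomes. *)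
Lemma bweight_expectation x (g : 'I_n * 'I_N -> bool -> R) :
  \sum_om bweight x om * \prod_p g p (om p) =
  \prod_p (x 0 p.1 * g p true + (1 - x 0 p.1) * g p false).
Proof.
transitivity (\prod_p \sum_b (if b then x 0 p.1 else 1 - x 0 p.1) * g p b).
  rewrite bigA_distr_bigA; apply: eq_bigr => om _.
  by rewrite /bweight -big_split.
by apply: eq_bigr => p _; rewrite big_bool.
Qed.

Lemma bweight_sum x : \sum_om bweight x om = 1.
Proof.
transitivity (\sum_om bweight x om * \prod_(p : 'I_n * 'I_N) 1).
  by apply: eq_bigr => om _; rewrite big1 ?mulr1.
rewrite (bweight_expectation x (fun _ _ => 1)) big1// => p _; ring.
Qed.

Lemma bweight_covariance x (i : 'I_n) (j k : 'I_N) :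
  \sum_om bweight x om * (((om (i, j))%:R - x 0 i) * ((om (i, k))%:R - x 0 i)) =
  (x 0 i * (1 - x 0 i)) *+ (j == k).
Proof.
(* The centred variable of trial [(i, j)] becomes a product over all trials with trivial factors
   elsewhere. For distinct trials its mean, 0, splits off. *)
pose d (j : 'I_N) p (b : bool) : R := if p == (i, j) then b%:R - x 0 i else 1.
have dE l om : \prod_p d l p (om p) = (om (i, l))%:R - x 0 i.
  by rewrite -big_mkcond big_pred1_eq.
under eq_bigr do rewrite -!dE -big_split/=.
rewrite (bweight_expectation x (fun p b => d j p b * d k p b)) (bigD1 (i, j))//=.
rewrite /d eqxx xpair_eqE eqxx/=; case: eqP => [->|_].
  rewrite big1 ?mulr1 ?mulr1n; last by move=> p /negbTE ->; ring.
  by rewrite mulr0n; ring.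
by rewrite !mulr1 mulr0n [X in X * _](_ : _ = 0) ?mul0r//; ring.
Qed.

(** Only the diagonal covariances survive, leaving [x 0 i * (1 - x 0 i) / N]. *)
Lemma bweight_variance x (i : 'I_n) : cube n x -> (0 < N)%N ->
  \sum_om bweight x om * (bmean om 0 i - x 0 i) ^+ 2 <= N%:R^-1.
Proof.
move=> cx N0; have Npos : 0 < N%:R :> R by rewrite ltr0n.
have dev om : bmean om 0 i - x 0 i = N%:R^-1 * \sum_(j < N) ((om (i, j))%:R - x 0 i).
  rewrite mxE sumrB sumr_const card_ord -[x 0 i *+ N]mulr_natl mulrBr mulKf ?gt_eqF//.
  by rewrite mulrC.
under eq_bigr do rewrite dev exprMn mulrCA [X in _ * (_ * X)]expr2 big_distrlr/= mulr_sumr.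
rewrite -mulr_sumr exchange_big/=.
under eq_bigr => j _ do under eq_bigr do rewrite mulr_sumr.
under eq_bigr => j _ do rewrite exchange_big/=.
under eq_bigr => j _ do under eq_bigr do rewrite bweight_covariance.
have -> : \sum_(j < N) \sum_(k < N) (x 0 i * (1 - x 0 i)) *+ (j == k)
    = N%:R * (x 0 i * (1 - x 0 i)).
  rewrite mulr_natl -[X in _ = _ *+ X]card_ord -sumr_const; apply: eq_bigr => j _.
  rewrite (bigD1 j)//= eqxx big1 ?addr0// => k kj.
  by rewrite eq_sym (negbTE kj).
rewrite expr2 -mulrA mulKf ?gt_eqF//.
have /andP[x0 x1] := cx i.
by rewrite ger_pMr ?invr_gt0//; nra.
Qed.

End bernstein.

(** * Weierstrass approximation on the cube *)

Section weierstrass.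
Context {R : realType} {n : nat}.

(** Chebyshev's argument: the increment of [f] is below [e / 2] at close points and below a multiple
    of the squared distance elsewhere. Averaging brings in the variances. *)
Lemma bernstein_approximation (f : 'rV[R]_n -> R) : {within cube n, continuous f} ->
  forall e, 0 < e -> exists N, forall x, cube n x -> `|bernstein (N := N) f x - f x| < e.
Proof.
move=> cf e e0; have e2 : 0 < e / 2 by rewrite divr_gt0.
have [d d0 unif] := compact_uniform_continuity (@cube_compact R n) cf e2.
have [M M0 fM] : exists2 M, 0 <= M & forall x, cube n x -> `|f x| <= M.
  have /compact_bounded[M [_ MP]] := continuous_compact cf (@cube_compact R n).
  exists (`|M| + 1); first by rewrite addr_ge0.
  move=> x cx; apply: (MP (`|M| + 1)); last by exists x.
  by rewrite (le_lt_trans (ler_norm M))// ltrDl.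
(* With this [c], a squared distance of at least [d ^+ 2] already pays for the trivial bound
   [2 * M]. *)
pose c := 2 * M / d ^+ 2.
have c0 : 0 <= c by apply: divr_ge0; [exact: mulr_ge0|exact: sqr_ge0].
have fc x y : cube n x -> cube n y ->
    `|f y - f x| <= e / 2 + c * \sum_i (y 0 i - x 0 i) ^+ 2.
  move=> cx cy; have [near|] := pselect (forall i, `|x 0 i - y 0 i| < d).
    rewrite distrC; apply: (@le_trans _ _ (e / 2)).
      by apply/ltW/unif => //; split => // i j; rewrite ord1; exact: near.
    by rewrite lerDl mulr_ge0// sumr_ge0// => i _; exact: sqr_ge0.
  move=> /existsNP[i /negP]; rewrite -leNgt => di.
  apply: (@le_trans _ _ (2 * M)).
    by apply: le_trans (ler_normB _ _) _; rewrite mulr_natl mulr2n lerD ?fM.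
  rewrite -[leLHS]add0r lerD// ?(ltW e2)//.
  have -> : c * \sum_i (y 0 i - x 0 i) ^+ 2 = 2 * M * ((\sum_i (y 0 i - x 0 i) ^+ 2) / d ^+ 2).
    by rewrite /c mulrAC mulrA.
  rewrite ler_peMr ?mulr_ge0//.
  rewrite ler_pdivlMr ?exprn_gt0// mul1r (bigD1 i)//=.
  rewrite -[leLHS]addr0 lerD ?sumr_ge0//; last by move=> j _; exact: sqr_ge0.
  by rewrite -[leRHS]real_normK ?num_real// distrC lerXn2r ?nnegrE// ltW.
(* The [n] coordinate variances add up to at most [n / N]; this [N] brings [c] times that below
   [e / 2]. *)
pose N := (Num.truncn (c * n%:R / (e / 2))).+1.
have N0 : 0 < N%:R :> R by rewrite ltr0n.
exists N => x cx.
have -> : bernstein (N := N) f x - f x = \sum_om (f (bmean om) - f x) * bweight (N := N) x om.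
  rewrite -[X in _ - X]mulr1 -(bweight_sum (N := N) x) mulr_sumr -sumrB.
  by apply: eq_bigr => om _; rewrite mulrBl.
apply: le_lt_trans (ler_norm_sum _ _ _) _.
apply: (@le_lt_trans _ _ (e / 2 + c * (n%:R * N%:R^-1))); last first.
  rewrite [ltRHS]splitr ltrD2l mulrA ltr_pdivrMr// [ltRHS]mulrC -ltr_pdivrMr//.
  exact: truncnS_gt.
apply: (@le_trans _ _ (\sum_om (bweight x om * (e / 2)
    + c * \sum_i bweight (N := N) x om * (bmean om 0 i - x 0 i) ^+ 2))).
  apply: ler_sum => om _; rewrite normrM [`|bweight _ _|]ger0_norm ?bweight_ge0//.
  rewrite -mulr_sumr [c * _]mulrCA -mulrDr [leLHS]mulrC ler_wpM2l ?bweight_ge0// fc//.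
  exact: bmean_cube.
rewrite big_split/= -mulr_suml bweight_sum mul1r lerD2l -mulr_sumr ler_wpM2l//.
rewrite exchange_big/=; apply: (@le_trans _ _ (\sum_(i < n) N%:R^-1)).
  by apply: ler_sum => i _; exact: bweight_variance.
by rewrite sumr_const card_ord mulr_natl.
Qed.

Lemma approximable_continuous (sigma : R -> R) (f : 'rV[R]_n -> R) :
  (forall k, @ridge_approximable R n sigma (fun t => t ^+ k)) ->
  {within cube n, continuous f} -> approximable sigma f.
Proof.
move=> mono cf; apply: approximable_lim => e e0.
have [N NP] := bernstein_approximation cf e0.
exists (bernstein (N := N) f) => //; apply: approximable_sum => om.
apply: approximableZ.
(* Sign and shift encode the factor [x 0 p.1] for a success and [1 - x 0 p.1] for a failure. *)
pose w (p : 'I_n * 'I_N) : 'cV[R]_n := (-1) ^+ (~~ om p) *: delta_mx p.1 0.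
apply: eq_approximable (approximable_prod_affine mono (index_enum _) w
  (fun p => (~~ om p)%:R)) => x.
apply: eq_bigr => p _; rewrite /affine /w -scalemxAr -colE !mxE.
by case: (om p) => /=; rewrite ?expr0 ?expr1; ring.
Qed.

End weierstrass.

(** * Structured weight matrices *)

Lemma eigs_distinct_abs_eigenvalue {R : realType} (n : nat) (B : 'M[R]_n) :
  (0 < n)%N -> eigs_distinct_abs B -> exists a : R, eigenvalue B a.
Proof.
move=> n0 [lam [charB distinct]]; pose i0 := Ordinal n0.
pose toC := real_complex R.
have rootlam z : root (char_poly (map_mx toC B)) z -> exists i, z = lam i.
  rewrite (charB : char_poly (map_mx toC B) = _).
  rewrite -(big_map lam xpredT (fun z => 'X - z%:P)) root_prod_XsubC.
  by move=> /mapP[i _ ->]; exists i.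
have root0 : root (char_poly (map_mx toC B)) (lam i0).
  rewrite (charB : char_poly (map_mx toC B) = _).
  rewrite -(big_map lam xpredT (fun z => 'X - z%:P)) root_prod_XsubC.
  by rewrite map_f ?mem_index_enum.
(* The characteristic polynomial has real coefficients, so conjugation permutes its roots; it also
   preserves absolute values. *)
have [j lamj] : exists j, conjc (lam i0) = lam j.
  apply: rootlam; have -> : map_mx toC B = map_mx (@conjc R) (map_mx toC B).
    by apply/matrixP => i j; rewrite !mxE /toC conjc_real.
  by rewrite -map_char_poly fmorph_root.
have conj0 : conjc (lam i0) = lam i0.
  rewrite lamj; congr lam; apply/eqP; apply: contraT => /distinct; rewrite -lamj.
  by case: (lam i0) => u v; rewrite !normc_def/= sqrrN eqxx.
have lamR : lam i0 = toC (complex.Re (lam i0)).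
  case: (lam i0) conj0 => u v [] /eqP; rewrite eq_sym -subr_eq0 opprK -mulr2n mulrn_eq0/=.
  by move=> /eqP ->.
exists (complex.Re (lam i0)); rewrite eigenvalue_root_char.
by move: root0; rewrite lamR -map_char_poly fmorph_root.
Qed.

Theorem theorem2 (R : realType) (sigma : R -> R) (n : nat)
  (A B : 'M[R]_n) (q : nat) (a : R) :
  continuous sigma -> discriminatory n sigma ->
  (1 <= n)%N ->
  A \in unitmx -> B \in unitmx ->
  diagonalizableC A -> diagonalizableC B ->
  (0 < q)%N -> (q <= n)%N -> a != 0 -> A ^+ q = a%:M ->
  (1%:M - a *: B ^+ q) \in unitmx ->
  eigs_distinct_abs B ->
  forall f : 'rV[R]_n -> R, {within cube n, continuous f} ->
  forall eps : R, 0 < eps ->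
  exists k : nat, (0 < k)%N /\
  exists W : 'M[R]_(n, k * n),
    (forall i : 'I_k, exists g h : 'cV[R]_n,
        block W i - A *m block W i *m B = g *m h^T) /\
    exists alpha theta : 'I_(k * n) -> R,
      forall x : 'rV[R]_n, x \in cube n ->
        `| \sum_(j < k * n) alpha j * sigma ((x *m W) 0 j + theta j) - f x | < eps.
Proof.
move=> csigma discr n0 _ _ _ _ _ _ _ _ _ Bdist f cf eps eps0.
have mono k : @ridge_approximable R n sigma (fun t => t ^+ k).
  by apply: ridge_monomial => //; exact: discriminatory_fdiff_neq0 n0 csigma discr.
have [s sf] := approximable_continuous mono cf eps0.
have [mu /eigenvalueP[v vB v0]] := eigs_distinct_abs_eigenvalue n0 Bdist.
have [c vc] : exists c, v 0 c != 0.
  apply: contrapT => /forallNP vz; case/eqP: v0; apply/rowP => c; rewrite mxE.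
  by apply/eqP; apply: contrapT => /negP; exact: vz.
pose h : 'cV[R]_n := ((v 0 c)^-1 *: v)^T.
have hB : h^T *m B = mu *: h^T by rewrite trmxK -scalemxAl vB scalerA mulrC -scalerA.
have hc : h c 0 = 1 by rewrite !mxE mulVf.
(* A dummy null neuron makes the number of blocks positive. *)
pose t := (0, 0, 0) :: s.
have tf x : network sigma t x = network sigma s x.
  by rewrite /network big_cons mul0r add0r.
pose p (i : nat) := nth (0 : 'cV[R]_n, 0 : R, 0 : R) t i.
pose k := size t.
pose blk (j : 'I_(k * n)) := (j %/ n)%N.
pose pos (j : 'I_(k * n)) := Ordinal (ltn_pmod j n0).
have blk_col (i : 'I_k) l : blk (block_col i l) = i.
  by rewrite /blk/= divnMDl// divn_small// addn0.
have pos_col (i : 'I_k) l : pos (block_col i l) = l.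
  by apply: val_inj; rewrite /= modnMDl modn_small.
exists k; split => //.
exists (\matrix_(r, j) ((p (blk j)).1.1 r 0 * h (pos j) 0)); split.
  move=> i; exists ((p i).1.1 - mu *: (A *m (p i).1.1)), h.
  have -> : block (\matrix_(r, j) ((p (blk j)).1.1 r 0 * h (pos j) 0)) i = (p i).1.1 *m h^T.
    apply/matrixP => r l; rewrite !mxE big_ord1 !mxE.
    by rewrite blk_col pos_col.
  by rewrite mulmxA -[_ *m h^T *m B]mulmxA hB -scalemxAr mulmxBl -scalemxAl.
(* Block [i] realises neuron [i] of [t] through its column [c], which is the neuron's direction
   because [h c 0 = 1]. *)
exists (fun j => if pos j == c then (p (blk j)).2 else 0).
exists (fun j => (p (blk j)).1.2) => x /set_mem cx.
suff -> : \sum_(j < k * n) (if pos j == c then (p (blk j)).2 else 0) *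
    sigma ((x *m \matrix_(r, j) ((p (blk j)).1.1 r 0 * h (pos j) 0)) 0 j + (p (blk j)).1.2)
    = network sigma t x by rewrite tf; exact: sf.
rewrite /network (big_nth (0, 0, 0)) big_mkord.
rewrite (eq_bigr (fun j => if pos j == c then (p (blk j)).2 *
    sigma (affine (p (blk j)).1.1 (p (blk j)).1.2 x) else 0)); last first.
  move=> j _; case: eqP => [jc|_]; last by rewrite mul0r.
  congr (_ * sigma (_ + _)); rewrite !mxE; apply: eq_bigr => r _.
  by rewrite mxE jc hc mulr1.
have blk_lt (j : 'I_(k * n)) : (blk j < k)%N by rewrite ltn_divLR.
(* The columns in position [c] correspond to the blocks by Euclidean division by [n]. *)
rewrite -big_mkcond (reindex_onto (fun i => block_col i c) (fun j => Ordinal (blk_lt j))).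
  apply: eq_big => [i|i _].
    by rewrite pos_col eqxx; apply/eqP/val_inj; exact: blk_col.
  by rewrite blk_col.
move=> j /eqP jc; apply: val_inj; rewrite /= -jc /= /blk.
by rewrite -divn_eq.
Qed.
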